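(* Let $(C,\phi)$ be an $n$-component semicoherent system with continuous and i.i.d. component lifetimes, with signature $(s_1,\ldots,s_n)$ and domination vector $(d_1,\ldots,d_n)$. Then $$s_k = \sum_{j=0}^{n-k}\frac{\binom{n-j}{k}}{\binom{n}{k}}\,\frac{j+1}{n-j}\,d_{j+1} = \sum_{j=1}^{n-k+1}\frac{\binom{n-k}{j-1}}{\binom{n}{j}}\,d_{j},\qquad k=1,\ldots,n,$$ $$d_k = \binom{n}{k}\sum_{j=0}^{k-1}(-1)^{k-1-j}\binom{k-1}{j}\,s_{n-j},\qquad k=1,\ldots,n,$$ $$d_k = \binom{n}{k}\,\big(\Delta_i^{k-1}\,s_{n-i}\big)\big|_{i=0},\qquad k=1,\ldots,n.$$
   Context: $n\ge 1$, $C=[n]=\{1,\ldots,n\}$ is the set of components, and $\phi\colon\{0,1\}^n\to\{0,1\}$ is the structure function. The system is semicoherent: $\phi$ is nondecreasing in each variable, $\phi(0,\ldots,0)=0$ and $\phi(1,\ldots,1)=1$. Boolean vectors $\mathbf{x}\in\{0,1\}^n$ are identified with subsets $A\subseteq C$ by $x_i=1$ iff $i\in A$, so one writes $\phi(A)$. The components have continuous i.i.d. lifetimes $T_1,\ldots,T_n$; $T_{k:n}$ is the $k$-th smallest lifetime and $T_S$ is the system lifetime, i.e. the time at which the system fails, $T_S=\max_{A:\phi(A)=1}\min_{i\in A}T_i$. The signature is $\mathbf{s}=(s_1,\ldots,s_n)$ with $s_k=\Pr(T_S=T_{k:n})$. The reliability function is the multilinear polynomial function $h(x_1,\ldots,x_n)=\sum_{A\subseteq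 C}\phi(A)\prod_{i\in A}x_i\prod_{i\in C\setminus A}(1-x_i)$ on $[0,1]^n$; its diagonal section is the univariate polynomial $h(x)=h(x,\ldots,x)$, of degree at most $n$, and $d_k$ is the coefficient of $x^k$ in $h(x)$. $\Delta_i$ is the difference operator acting on sequences indexed by $i$: $\Delta_i z_i=z_{i+1}-z_i$, with $\Delta_i^0z_i=z_i$ and $\Delta_i^kz_i=\Delta_i\Delta_i^{k-1}z_i$; in the last formula it is applied to the sequence $z_i=s_{n-i}$, $i=0,\ldots,n-1$, and then evaluated at $i=0$. *)

(* Defs.v *)
From HB Require Import structures.
From mathcomp Require Import all_boot all_order all_algebra.
From mathcomp Require Import all_classical all_reals all_analysis.

Set Implicit Arguments.
Unset Strict Implicit.
Unset Printing Implicit Defensive.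
Import Order.TTheory GRing.Theory Num.Theory numFieldNormedType.Exports.

Local Open Scope classical_set_scope.
Local Open Scope ring_scope.

(* Components are numbered from 0: the component i of [n] is the element i - 1
   of 'I_n. A state vector x in {0,1}^n is the set of the indices i such that
   x_i = 1, so a structure function is a map {set 'I_n} -> bool. *)
Record semicoherent (n : nat) (phi : {set 'I_n} -> bool) : Prop := Semicoherent {
  semicoherent_incr : forall (A : {set 'I_n}) (i : 'I_n), phi A -> phi (i |: A)%SET;
  semicoherent0 : phi finset.set0 = false;
  semicoherentT : phi [set: 'I_n]%SET = true }.

Section lifetimes.
Context d (Omega : measurableType d) (R : realType) (P : probability Omega R).
Variable n : nat.

Definition mutually_independent (T : 'I_n -> {RV P >-> R}) : Prop :=
  forall (J : {set 'I_n}) (B : 'I_n -> set R),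
    (forall i, measurable (B i)) ->
    P (\bigcap_(i in [set` J]) (T i @^-1` B i))
      = (\prod_(i in J) P (T i @^-1` B i))%E.

Definition identically_distributed (T : 'I_n -> {RV P >-> R}) : Prop :=
  forall (i j : 'I_n) (B : set R), measurable B ->
    distribution P (T i) B = distribution P (T j) B.

(* "Continuous" means that the distribution function is continuous; a density
   need not exist. *)
Definition continuous_iid (T : 'I_n -> {RV P >-> R}) : Prop :=
  [/\ mutually_independent T, identically_distributed T
    & forall i, continuous (cdf (T i))].

(* T_{k:n} for 1 <= k <= n, the k-th smallest lifetime (k starts from 1). *)
Definition order_statistic (T : 'I_n -> {RV P >-> R}) (k : nat) (w : Omega) : R :=
  nth 0 (sort <=%R [seq T i w | i : 'I_n]) k.-1.

(* The max over path sets of the min over their components, taken in \bar R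
   to have neutral elements. For a semicoherent phi the max is over a nonempty
   family of nonempty sets, so the value is finite. *)
Definition system_lifetime (phi : {set 'I_n} -> bool)
    (T : 'I_n -> {RV P >-> R}) (w : Omega) : \bar R :=
  (\big[maxe/-oo]_(A : {set 'I_n} | phi A) \big[mine/+oo]_(i in A) (T i w)%:E)%E.

Definition signature (phi : {set 'I_n} -> bool) (T : 'I_n -> {RV P >-> R})
    (k : nat) : R :=
  fine (P [set w | system_lifetime phi T w = (order_statistic T k w)%:E]).

End lifetimes.

(* The multilinear expression of h makes sense over any commutative ring S:
   S = R gives the reliability function, S = {poly R} its diagonal section. *)
Definition reliability (S : comNzRingType) (n : nat) (phi : {set 'I_n} -> bool)
    (x : 'I_n -> S) : S :=
  \sum_(A : {set 'I_n})
    (phi A)%:R * (\prod_(i in A) x i) * \prod_(i in (~: A)%SET) (1 - x i).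

Definition diagonal_section (R : comNzRingType) (n : nat)
    (phi : {set 'I_n} -> bool) : {poly R} :=
  reliability phi (fun=> 'X).

Lemma horner_diagonal_section (R : comNzRingType) (n : nat)
    (phi : {set 'I_n} -> bool) (x : R) :
  (diagonal_section R phi).[x] = reliability phi (fun=> x).
Proof.
rewrite /diagonal_section /reliability horner_sum; apply: eq_bigr => A _.
rewrite !hornerM !horner_prod -polyC_natr hornerC.
by congr (_ * _ * _); apply: eq_bigr => i _; rewrite !hornerE.
Qed.

Definition domination (R : comNzRingType) (n : nat) (phi : {set 'I_n} -> bool)
    (k : nat) : R :=
  (diagonal_section R phi)`_k.

Definition difference (V : zmodType) (z : nat -> V) : nat -> V :=
  fun i => z i.+1 - z i.

(* Main.v *)
Require Import Defs.
From HB Require Import structures.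
From mathcomp Require Import all_boot all_order all_fingroup all_algebra.
From mathcomp Require Import all_classical all_reals all_analysis.
From mathcomp Require Import measurable_realfun ring zify.
Set Implicit Arguments.
Unset Strict Implicit.
Unset Printing Implicit Defensive.
Import Order.TTheory GRing.Theory Num.Theory numFieldNormedType.Exports.
Local Open Scope classical_set_scope.
Local Open Scope ring_scope.

(** Let p_m be the proportion of path sets among the m-element sets of
    components ([path_density]). The signature and the domination vector are
    two encodings of the sequence p, and all the formulas compare them.

    On the signature side, s_k = p_(n-k+1) - p_(n-k), which is Boland's formula
    ([signature_path_density]). Almost surely the lifetimes are distinct, and
    then for each m exactly one set of m components outlives its complement.
    The lifetimes being exchangeable, this set is uniformly distributed among
    the m-element sets ([top_set_probability]), so it is a path set with
    probability p_m ([top_is_path_probability]). The system works just before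
    the k-th failure iff the set of the n-k+1 longest-lived components is a path
    set, and just after it iff the set of the n-k longest-lived ones is; it
    fails at that time iff the first holds and the second does not
    ([maxmin_eq_nth_sort]).

    On the domination side, h(x) is the sum over m of
    C(n,m) p_m x^m (1-x)^(n-m), a polynomial in Bernstein form, whose
    coefficients in the monomial basis are d_k = C(n,k) (Delta^k p)(0)
    ([domination_difference]).

    Hence z_i = s_(n-i) is the difference sequence of p, and
    d_k = C(n,k) (Delta^(k-1) z)(0), the last formula of the theorem. Expanding
    Delta^(k-1) ([difference_expansion]) gives d in terms of s, and the forward
    formula of Newton ([newton_forward]), which recovers z from its iterated
    differences at 0, gives s in terms of d. The two forms of s_k agree term by
    term ([bin_absorb_quotient]). *)

(** * Finite differences and Bernstein coefficients *)

Lemma difference_expansion (V : pzRingType) (z : nat -> V) (k i : nat) :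
  iter k (@difference V) z i =
  \sum_(j < k.+1) (-1) ^+ (k - j) * 'C(k, j)%:R * z (i + j)%N.
Proof.
elim: k i => [|k IHk] i; first by rewrite big_ord1 /= expr0 bin0 !mul1r addn0.
rewrite iterS /difference !IHk [RHS]big_ord_recl big_ord_recr /= subnn.
rewrite [in RHS]big_ord_recr /= subn0 !bin0 !binn subSS subnn !addn0.
rewrite !mulr1 expr0 !mul1r.
rewrite [X in _ - X]big_ord_recl /= subn0 bin0 addn0 mulr1.
rewrite exprS mulN1r mulNr addSnnS.
rewrite opprD addrCA; congr (_ + _); rewrite addrAC; congr (_ + _).
rewrite -sumrB; apply: eq_bigr => j _.
rewrite /bump /= !add1n addSnnS -mulrBl subSS binS natrD mulrDr.
congr (_ * _); rewrite addrC; congr (_ + _); rewrite -mulNr; congr (_ * _).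
by rewrite -mulN1r -exprS subnSK.
Qed.

Lemma newton_forward (V : pzRingType) (z : nat -> V) (i : nat) :
  z i = \sum_(j < i.+1) 'C(i, j)%:R * iter j (@difference V) z 0%N.
Proof.
elim: i z => [|i IHi] z; first by rewrite big_ord1 /= mul1r.
have -> : z i.+1 = z i + difference z i by rewrite /difference addrC subrK.
rewrite (IHi z) (IHi (difference z)) [RHS]big_ord_recl.
rewrite [X in X + _]big_ord_recl /=.
rewrite !bin0 -addrA; congr (_ + _).
rewrite [in RHS](eq_bigr (fun j : 'I_i.+1 =>
   'C(i, j.+1)%:R * iter j.+1 (@difference V) z 0%N
   + 'C(i, j)%:R * iter j (@difference V) (difference z) 0%N)); last first.
  by move=> j _; rewrite /bump /= add1n binS natrD mulrDl -iterS iterSr.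
rewrite big_split /=; congr (_ + _).
by rewrite [RHS]big_ord_recr /= bin_small // mul0r addr0.
Qed.

Lemma coef_bernstein (R : comNzRingType) (m q k : nat) :
  ('X^m * (1 - 'X) ^+ q : {poly R})`_k =
  if (m <= k)%N then (-1) ^+ (k - m) * 'C(q, k - m)%:R else 0.
Proof.
rewrite mulrC coefMXn ltnNge; case: leqP => //= mk.
move: (k - m)%N => {mk m k} k.
rewrite exprBn coef_sum.
rewrite (eq_bigr (fun i : 'I_q.+1 =>
    if i == k :> nat then (-1) ^+ i * 'C(q, i)%:R else 0)); last first.
  move=> i _.
  rewrite coefMn expr1n mulr1 -polyC1 -polyCN -polyC_exp coefCM coefXn.
  by rewrite eq_sym; case: eqP; rewrite ?mulr1 ?mulr0 ?mul0rn // mulr_natr.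
rewrite -big_mkcond /=; case: (ltnP k q.+1) => kq.
  by rewrite (big_pred1 (Ordinal kq)).
rewrite big1 ?bin_small ?mulr0 // => i /eqP Ei; move: (ltn_ord i).
by rewrite Ei ltnNge kq.
Qed.

Definition path_count (n : nat) (phi : {set 'I_n} -> bool) (m : nat) : nat :=
  #|[set A : {set 'I_n} | phi A & #|A| == m]|.

Definition path_density (R : unitRingType) (n : nat) (phi : {set 'I_n} -> bool)
  (m : nat) : R := (path_count phi m)%:R / 'C(n, m)%:R.

Lemma domination_path_count (R : comNzRingType) (n : nat)
    (phi : {set 'I_n} -> bool) (k : nat) : (k <= n)%N ->
  domination R phi k = \sum_(m < k.+1)
    (path_count phi m)%:R * ((-1) ^+ (k - m) * 'C(n - m, k - m)%:R).
Proof.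
move=> kn; rewrite /domination /diagonal_section /reliability coef_sum.
have cA (A : {set 'I_n}) : (#|A| < n.+1)%N.
  by rewrite ltnS -[leqRHS]card_ord max_card.
rewrite (partition_big (fun A : {set 'I_n} => Ordinal (cA A)) predT) //=.
rewrite (eq_bigr (fun m : 'I_n.+1 => if (m < k.+1)%N then
   (path_count phi m)%:R * ((-1) ^+ (k - m) * 'C(n - m, k - m)%:R) else 0)).
  rewrite -big_mkcond /=.
  by rewrite (big_ord_widen n.+1 (fun m => (path_count phi m)%:R *
    ((-1) ^+ (k - m) * 'C(n - m, k - m)%:R)) _).
move=> m _; rewrite (eq_bigr (fun A : {set 'I_n} => (phi A)%:R *
   (if (m < k.+1)%N then (-1) ^+ (k - m) * 'C(n - m, k - m)%:R else 0 : R))).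
  rewrite -mulr_suml; case: ifP => _; rewrite ?mulr0 //; congr (_ * _).
  rewrite /path_count -sum1_card natr_sum.
  rewrite [RHS](eq_bigl (fun A => phi A && (#|A| == m))).
    by rewrite [RHS]big_mkcondl /=; apply: eq_big => // A _; case: (phi A).
  by move=> A; rewrite inE.
move=> A /eqP /(congr1 val) /= cAm.
have cCm : #|(~: A)%SET| = (n - m)%N.
  by rewrite cardsCs finset.setCK card_ord cAm.
rewrite !prodr_const cCm cAm -mulrA -polyC_natr coefCM.
by rewrite coef_bernstein.
Qed.

(** Both sides count the pairs M \subset K of subsets of an n-element set with
    #|M| = m and #|K| = k. *)
Lemma bin_mul_bin (n k m : nat) : (m <= k <= n)%N ->
  ('C(n, m) * 'C(n - m, k - m) = 'C(n, k) * 'C(k, m))%N.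
Proof.
move=> /andP[mk kn].
have mn := leq_trans mk kn.
have f0 : (0 < m`! * ((k - m)`! * (n - k)`!))%N by rewrite !muln_gt0 !fact_gt0.
have e1 := bin_fact mn; have e2 := bin_fact kn; have e3 := bin_fact mk.
have e4 : ('C(n - m, k - m) * ((k - m)`! * (n - k)`!) = (n - m)`!)%N.
  have -> : (n - k = (n - m) - (k - m))%N by lia.
  by apply: bin_fact; lia.
apply/eqP; rewrite -(eqn_pmul2r f0); apply/eqP.
transitivity n`!.
  by rewrite -e1 -e4; ring.
by rewrite -e2 -e3; ring.
Qed.

(** The passage from the Bernstein basis to the monomial basis. It puts the
    domination vector in terms of [path_density], as Boland's formula does for
    the signature. *)
Lemma domination_difference (R : numFieldType) (n : nat)
    (phi : {set 'I_n} -> bool) (k : nat) : (k <= n)%N ->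
  domination R phi k =
  'C(n, k)%:R * iter k (@difference R) (path_density R phi) 0%N.
Proof.
move=> kn; rewrite domination_path_count // difference_expansion mulr_sumr.
apply: eq_bigr => m _; rewrite add0n /path_density.
have mk : (m <= k <= n)%N by rewrite -ltnS ltn_ord.
have /(congr1 (fun x => x%:R : R)) := bin_mul_bin mk.
rewrite !natrM => e.
have nz : 'C(n, m)%:R != 0 :> R.
  by rewrite pnatr_eq0 -lt0n bin_gt0; case/andP: mk; apply: leq_trans.
apply: (mulfI nz).
transitivity ((path_count phi m)%:R * (-1) ^+ (k - m)
              * ('C(n, m)%:R * 'C(n - m, k - m)%:R) : R).
  by ring.
by rewrite e; field.
Qed.

Lemma bin_absorb_quotient (R : numFieldType) (n k j : nat) :
  (1 <= k <= n)%N -> (j <= n - k)%N ->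
  ('C(n - j, k)%:R / 'C(n, k)%:R) * (j.+1%:R / (n - j)%:R) =
  'C(n - k, j)%:R / 'C(n, j.+1)%:R :> R.
Proof.
move=> kn jnk.
have nf a : (a`!)%:R != 0 :> R by rewrite pnatr_eq0 -lt0n fact_gt0.
have E a b : (b <= a)%N ->
    'C(a, b)%:R = (a`!)%:R / ((b`!)%:R * ((a - b)`!)%:R) :> R.
  by move=> ab; rewrite -(bin_fact ab) !natrM mulfK // mulf_neq0.
rewrite !E; try lia.
have -> : (n - j = (n - j.+1).+1)%N by lia.
have -> : ((n - j.+1).+1 - k = n - k - j)%N by lia.
rewrite !factS !natrM; field.
by rewrite !nf !nat1r !pnatr_eq0.
Qed.

(** The algebraic half of the theorem: s may be any sequence that satisfies
    Boland's formula. *)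
Lemma path_density_difference_formulas (R : numFieldType) (n : nat)
    (phi : {set 'I_n} -> bool) (s : nat -> R) :
  (forall k : nat, (1 <= k <= n)%N ->
     s k = difference (path_density R phi) (n - k)) ->
  let d := domination R phi in
  [/\ forall k : nat, (1 <= k <= n)%N ->
        s k = \sum_(0 <= j < (n - k).+1)
                ('C(n - j, k)%:R / 'C(n, k)%:R) * (j.+1%:R / (n - j)%:R) * d j.+1
        /\
        s k = \sum_(1 <= j < (n - k + 1).+1)
                ('C(n - k, j.-1)%:R / 'C(n, j)%:R) * d j,
      forall k : nat, (1 <= k <= n)%N ->
        d k = 'C(n, k)%:R *
              \sum_(0 <= j < k) (-1) ^+ (k.-1 - j) * 'C(k.-1, j)%:R * s (n - j)%N
    & forall k : nat, (1 <= k <= n)%N ->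
        d k = 'C(n, k)%:R *
              iter k.-1 (@difference R) (fun i : nat => s (n - i)%N) 0%N].
Proof.
move=> sE d.
have dE k : (1 <= k <= n)%N -> d k = 'C(n, k)%:R *
    \sum_(0 <= j < k) (-1) ^+ (k.-1 - j) * 'C(k.-1, j)%:R * s (n - j)%N.
  case: k => // k /andP[_ kn]; rewrite /d domination_difference // iterSr.
  rewrite difference_expansion big_mkord /=; congr (_ * _).
  apply: eq_bigr => j _.
  have jn : (j < n)%N := leq_trans (ltn_ord j) kn.
  rewrite add0n sE ?subn_gt0 ?jn ?leq_subr //.
  by rewrite subKn // ltnW.
have sd k : (1 <= k <= n)%N -> s k =
    \sum_(0 <= j < (n - k).+1) ('C(n - k, j)%:R / 'C(n, j.+1)%:R) * d j.+1.
  move=> kn; rewrite sE // newton_forward big_mkord; apply: eq_bigr => j _.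
  have jn : (j.+1 <= n)%N by have := ltn_ord j; lia.
  rewrite /d domination_difference // iterSr mulrA divfK //.
  by rewrite pnatr_eq0 -lt0n bin_gt0.
split=> // k kn; first split.
- rewrite sd // !big_mkord; apply: eq_bigr => j _.
  by rewrite bin_absorb_quotient // -ltnS.
- by rewrite sd // big_add1 /= addn1.
rewrite dE // difference_expansion; case: k kn => // k kn.
by rewrite big_mkord.
Qed.

(** * Failure time of a system with given lifetimes *)

Lemma semicoherent_subset (n : nat) (phi : {set 'I_n} -> bool)
    (A B : {set 'I_n}) :
  semicoherent phi -> A \subset B -> phi A -> phi B.
Proof.
move=> [incr _ _] AB phiA; rewrite -(finset.setUidPr AB) finset.setUC.
have -> : (B :|: A = \bigcup_(i in B) [set i] :|: A)%SET.
  congr (_ :|: _)%SET; apply/setP => i.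
  apply/idP/finset.bigcupP => [iB|[j jB]].
    by exists i; rewrite ?finset.set11.
  by rewrite finset.in_set1 => /eqP ->.
elim/big_rec: _ => [|i C _ phiC]; first by rewrite finset.set0U.
by rewrite -finset.setUA; apply: incr.
Qed.

Section fixed_lifetimes.
Context {R : realType} {n : nat} (phi : {set 'I_n} -> bool)
  (phi_semicoherent : semicoherent phi) (x : 'I_n -> R).

Definition maxmin : \bar R :=
  (\big[maxe/-oo]_(A : {set 'I_n} | phi A) \big[mine/+oo]_(i in A) (x i)%:E)%E.

(** The best path set for lasting until y is the set of all the components that
    do so, because phi is nondecreasing. *)
Lemma maxmin_ge (y : R) :
  (y%:E <= maxmin)%E = phi [set j | y <= x j]%SET.
Proof.
apply/idP/idP => [|phiy]; last first.
  apply: le_trans (le_bigmax_cond _ _ phiy).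
  by apply: le_bigmin => [|i]; rewrite ?leey // finset.in_set lee_fin.
apply: contraTT => nphi; rewrite -ltNge.
apply: bigmax_lt => [|A phiA]; first exact: ltNyr.
have /subsetPn[i iA] : ~~ (A \subset [set j | y <= x j]%SET).
  by apply: contra nphi => /semicoherent_subset; apply.
rewrite finset.in_set -ltNge => xy.
by apply: le_lt_trans (bigmin_le_cond _ _ iA) _; rewrite lte_fin.
Qed.

Lemma maxmin_gt (y : R) :
  (y%:E < maxmin)%E = phi [set j | y < x j]%SET.
Proof.
apply/idP/idP => [|phiy]; last first.
  apply: lt_le_trans (le_bigmax_cond _ _ phiy).
  by apply: lt_bigmin => [|i]; rewrite ?ltry // finset.in_set lte_fin.
apply: contraTT => nphi; rewrite -leNgt.
apply: bigmax_le => [|A phiA]; first exact: leNye.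
have /subsetPn[i iA] : ~~ (A \subset [set j | y < x j]%SET).
  by apply: contra nphi => /semicoherent_subset; apply.
rewrite finset.in_set -leNgt => xy.
by apply: le_trans (bigmin_le_cond _ _ iA) _; rewrite lee_fin.
Qed.

Lemma maxmin_eq (y : R) : maxmin = y%:E <->
  phi [set j | y <= x j]%SET && ~~ phi [set j | y < x j]%SET.
Proof.
rewrite -maxmin_ge -maxmin_gt -leNgt; split=> [->|H]; first by rewrite lexx.
by apply/eqP; rewrite eq_le andbC.
Qed.

Lemma count_sort_image (a : pred R) :
  count a (sort <=%R [seq x i | i : 'I_n]) = #|[set j | a (x j)]%SET|.
Proof.
rewrite count_sort /image_mem count_map cardE size_filter.
rewrite count_filter; apply: eq_count => i.
by rewrite /= finset.in_set andb_idr.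
Qed.

Lemma nth_sort_eq (m : nat) (y : R) : (m < n)%N ->
  (nth 0 (sort <=%R [seq x i | i : 'I_n]) m == y) =
  (#|[set j | (x j < y)%R]%SET| <= m < #|[set j | (x j <= y)%R]%SET|)%N.
Proof.
move=> mn; set s := sort _ _.
have ss : sorted <=%R s := sort_le_sorted _.
have szs : size s = n by rewrite size_sort size_image card_ord.
rewrite -(count_sort_image (< y)) -(count_sort_image (<= y)) -/s.
apply/eqP/idP => [<-|/nth_count_eq ->//].
apply/andP; split; rewrite leqNgt; apply/negP => H.
  by have := nth_count_lt 0 ss H; rewrite ltxx.
have: nth 0 s m < nth 0 s m; last by rewrite ltxx.
by apply: nth_count_gt => //; rewrite szs mn andbT -ltnS.
Qed.

Definition top_set (A : {set 'I_n}) : bool :=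
  [forall i, forall j, (i \notin A) && (j \in A) ==> (x i < x j)].

Lemma top_setP (A : {set 'I_n}) :
  reflect (forall i j, i \notin A -> j \in A -> x i < x j) (top_set A).
Proof.
apply: (iffP forallP) => [H i j iA jA|H i].
  by have /forallP/(_ j) := H i; rewrite iA jA.
by apply/forallP => j; apply/implyP => /andP[]; apply: H.
Qed.

(** Two top sets are comparable for inclusion: elements i of A \ B and j of
    B \ A would satisfy both x j < x i and x i < x j. *)
Lemma top_set_inj (A B : {set 'I_n}) :
  top_set A -> top_set B -> #|A| = #|B| -> A = B.
Proof.
move=> /top_setP tA /top_setP tB cAB; apply/eqP.
have [AB|/subsetPn[i iA iB]] := boolP (A \subset B).
  by rewrite eqEcard AB cAB leqnn.
rewrite eq_sym eqEcard cAB leqnn andbT; apply/fintype.subsetP => j jB.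
apply/negPn/negP => jA.
by have := lt_trans (tA _ _ jA iA) (tB _ _ iB jB); rewrite ltxx.
Qed.

Lemma top_set_ge (y : R) : top_set [set j | y <= x j]%SET.
Proof.
by apply/top_setP => i j; rewrite !finset.in_set -ltNge; apply: lt_le_trans.
Qed.

Lemma top_set_gt (y : R) : top_set [set j | y < x j]%SET.
Proof.
by apply/top_setP => i j; rewrite !finset.in_set -leNgt; apply: le_lt_trans.
Qed.

Lemma card_above_nth_sort (m : nat) : injective x -> (m < n)%N ->
  let y := nth 0 (sort <=%R [seq x i | i : 'I_n]) m in
  #|[set j | y < x j]%SET| = (n - m.+1)%N /\
  #|[set j | y <= x j]%SET| = (n - m)%N.
Proof.
move=> injx mn y.
have := nth_sort_eq y mn; rewrite eqxx => /esym/andP[le_m lt_m].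
have C (a : pred R) :
    #|[set j | ~~ a (x j)]%SET| = (n - #|[set j | a (x j)]%SET|)%N.
  have -> : [set j | ~~ a (x j)]%SET = (~: [set j | a (x j)])%SET.
    by apply/setP => j; rewrite !finset.inE.
  by rewrite cardsCs finset.setCK card_ord.
(* at most one component fails exactly at time y *)
have eqy : (#|[set j | (x j <= y)%R]%SET| <= #|[set j | (x j < y)%R]%SET| + 1)%N.
  have -> : [set j | x j <= y]%SET
      = ([set j | x j < y] :|: [set j | x j == y])%SET.
    by apply/setP => j; rewrite !finset.in_set le_eqVlt orbC.
  rewrite cardsU; apply: leq_trans (leq_subr _ _) _; rewrite leq_add2l.
  apply/card_le1P => i; rewrite finset.in_set => /eqP xi j.
  by rewrite !finset.inE -xi (inj_eq injx).
have cl : #|[set j | (x j < y)%R]%SET| = m by lia.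
have cle : #|[set j | (x j <= y)%R]%SET| = m.+1 by lia.
rewrite -{1}cle -{1}cl -(C (< y)) -(C (<= y)).
by split; apply: eq_card => j; rewrite !finset.in_set ?ltNge ?negbK // leNgt.
Qed.

Lemma top_set_exists (m : nat) : injective x -> (m <= n)%N ->
  exists2 A : {set 'I_n}, #|A| = m & top_set A.
Proof.
case: m => [|m] injx mn.
  exists finset.set0; rewrite ?cards0 //.
  by apply/top_setP => i j; rewrite !finset.in_set0.
have [|_ c] := @card_above_nth_sort (n - m.+1) injx.
  by rewrite ltn_subrL (leq_ltn_trans _ mn).
by exists [set j | nth 0 (sort <=%R [seq x i | i : 'I_n]) (n - m.+1) <= x j]%SET;
  [rewrite c subKn | apply: top_set_ge].
Qed.

Definition top_is_path (m : nat) : bool :=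
  [exists A : {set 'I_n}, [&& phi A, #|A| == m & top_set A]].

Lemma top_is_pathP (m : nat) :
  reflect (exists2 A : {set 'I_n}, phi A && (#|A| == m) & top_set A)
    (top_is_path m).
Proof.
apply: (iffP existsP) => [[A /and3P[pA cA tA]]|[A /andP[pA cA] tA]].
  by exists A; rewrite ?pA.
by exists A; rewrite pA cA.
Qed.

Lemma top_is_pathE (A : {set 'I_n}) : top_set A -> top_is_path #|A| = phi A.
Proof.
move=> tA; apply/top_is_pathP/idP => [[B /andP[phiB /eqP cB] tB]|phiA].
  by rewrite (top_set_inj tA tB).
by exists A; rewrite ?phiA ?eqxx.
Qed.

Lemma maxmin_eq_nth_sort (m : nat) : injective x -> (m < n)%N ->
  maxmin = (nth 0 (sort <=%R [seq x i | i : 'I_n]) m)%:E <->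
  top_is_path (n - m) && ~~ top_is_path (n - m.+1).
Proof.
move=> injx mn; rewrite maxmin_eq.
have [<- <-] := card_above_nth_sort injx mn.
by rewrite !top_is_pathE ?top_set_ge ?top_set_gt.
Qed.

Lemma top_is_path_succ (m : nat) : injective x -> (m < n)%N ->
  top_is_path (n - m.+1) -> top_is_path (n - m).
Proof.
move=> injx mn; have [<- <-] := card_above_nth_sort injx mn.
rewrite !top_is_pathE ?top_set_ge ?top_set_gt //.
apply: semicoherent_subset => //; apply/fintype.subsetP => j.
by rewrite !finset.in_set; apply: ltW.
Qed.

(** All the events below depend only on the weak order of the lifetimes, which
    takes finitely many values; this gives their measurability. *)
Definition comparisons : {ffun 'I_n * 'I_n -> bool} :=
  [ffun p => x p.1 <= x p.2].

Lemma top_set_comparisons (A : {set 'I_n}) : top_set A =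
  [forall i, forall j, (i \notin A) && (j \in A) ==> ~~ comparisons (j, i)].
Proof.
by apply: eq_forallb => i; apply: eq_forallb => j; rewrite ffunE /= -ltNge.
Qed.

Lemma injective_comparisons : injective x <->
  [forall i, forall j, comparisons (i, j) && comparisons (j, i) ==> (i == j)].
Proof.
split=> [injx|/forallP H i j eqx].
  apply/forallP => i; apply/forallP => j; rewrite !ffunE /= -eq_le.
  by apply/implyP => /eqP /injx ->.
by have /forallP/(_ j) := H i; rewrite !ffunE /= eqx lexx => /eqP.
Qed.

End fixed_lifetimes.

(** Here c (i, j) stands for: i fails no later than j. The two cardinals say
    that the lifetime of i is the m-th in increasing order, counted from 0. *)
Definition fails_at_nth (n : nat) (phi : {set 'I_n} -> bool) (m : nat)
    (c : {ffun 'I_n * 'I_n -> bool}) : bool :=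
  [exists i,
    [&& (#|[set j | ~~ c (i, j)]%SET| <= m < #|[set j | c (j, i)]%SET|)%N,
        phi [set j | c (i, j)]%SET & ~~ phi [set j | ~~ c (j, i)]%SET]].

(** Unlike [maxmin_eq_nth_sort], this allows ties, so that it describes the
    event on the whole probability space. *)
Lemma maxmin_eq_comparisons (R : realType) (n : nat) (phi : {set 'I_n} -> bool)
    (x : 'I_n -> R) (m : nat) : semicoherent phi -> (m < n)%N ->
  maxmin phi x = (nth 0 (sort <=%R [seq x i | i : 'I_n]) m)%:E <->
  fails_at_nth phi m (comparisons x).
Proof.
move=> phi_semicoherent mn; set c := comparisons x.
have E i : [/\ [set j | ~~ c (i, j)]%SET = [set j | x j < x i]%SET,
    [set j | c (j, i)]%SET = [set j | x j <= x i]%SET,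
    [set j | c (i, j)]%SET = [set j | x i <= x j]%SET
  & [set j | ~~ c (j, i)]%SET = [set j | x i < x j]%SET].
  by split; apply/setP => j; rewrite !finset.in_set !ffunE //= ltNge.
split.
  have : nth 0 (sort <=%R [seq x i | i : 'I_n]) m \in [seq x i | i : 'I_n].
    by rewrite -(mem_sort <=%R) mem_nth // size_sort size_image card_ord.
  case/fintype.imageP => i _ yi; rewrite yi maxmin_eq // => phi_i.
  apply/existsP; exists i; have [-> -> -> ->] := E i.
  by rewrite -nth_sort_eq // yi eqxx.
case/existsP => i; have [-> -> -> ->] := E i.
by rewrite -nth_sort_eq // => /andP[/eqP ->]; rewrite maxmin_eq.
Qed.

(** * Measurability *)

Lemma measurable_finite_pattern d (Omega : measurableType d) (I : finType)
    (b : I -> Omega -> bool) (Q : {ffun I -> bool} -> bool) :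
  (forall i, measurable_fun setT (b i)) ->
  measurable [set w | Q [ffun i => b i w]].
Proof.
move=> mb.
have -> : [set w | Q [ffun i => b i w]] =
    \bigcup_(c in [set c | Q c]) \bigcap_(i in setT) (b i @^-1` [set c i]).
  apply/seteqP; split=> [w Qw|w [c Qc bc]].
    by exists [ffun i => b i w] => // i _; rewrite /= ffunE.
  rewrite /= (_ : [ffun i => b i w] = c) //.
  by apply/ffunP => i; rewrite ffunE bc.
apply: fin_bigcup_measurable => // c _; apply: fin_bigcap_measurable => // i _.
by rewrite -[X in measurable X]setTI; apply: mb.
Qed.

Section measurability.
Context d (U : measurableType d) (R : realType) (n : nat) (f : 'I_n -> U -> R)
  (mf : forall i, measurable_fun setT (f i)).

Lemma measurable_comparisons (Q : {ffun 'I_n * 'I_n -> bool} -> bool) :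
  measurable [set w | Q (comparisons (fun i => f i w))].
Proof.
by apply: measurable_finite_pattern => p; apply: measurable_fun_ler.
Qed.

Lemma measurable_top_set (A : {set 'I_n}) :
  measurable [set w | top_set (fun i => f i w) A].
Proof.
under eq_set do rewrite top_set_comparisons.
exact: (measurable_comparisons (fun c =>
  [forall i, forall j, (i \notin A) && (j \in A) ==> ~~ c (j, i)])).
Qed.

Lemma measurable_top_is_path (phi : {set 'I_n} -> bool) (m : nat) :
  measurable [set w | top_is_path phi (fun i => f i w) m].
Proof.
rewrite (_ : [set w | _] =
    \bigcup_(A in [set` fun A : {set 'I_n} => phi A && (#|A| == m)])
      [set w | top_set (fun i => f i w) A]); last first.
  by apply/seteqP; split=> w /top_is_pathP.
by apply: fin_bigcup_measurable => // A _; apply: measurable_top_set.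
Qed.

Lemma measurable_distinct : measurable [set w | injective (fun i => f i w)].
Proof.
have := measurable_comparisons (fun c =>
  [forall i, forall j, c (i, j) && c (j, i) ==> (i == j)]).
rewrite (_ : [set w | _] = [set w | injective (fun i => f i w)]) //.
by apply/seteqP; split=> w; have [? ?] := injective_comparisons (fun i => f i w).
Qed.

Lemma measurable_maxmin_eq_nth_sort (phi : {set 'I_n} -> bool) (m : nat) :
  semicoherent phi -> (m < n)%N ->
  measurable [set w | maxmin phi (fun i => f i w) =
    (nth 0 (sort <=%R [seq f i w | i : 'I_n]) m)%:E].
Proof.
move=> phi_semicoherent mn.
have := measurable_comparisons (fails_at_nth phi m).
rewrite (_ : [set w | _] = [set w | maxmin phi (fun i => f i w) =
    (nth 0 (sort <=%R [seq f i w | i : 'I_n]) m)%:E]) //.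
by apply/seteqP; split=> w;
  have [life_c c_life] :=
    maxmin_eq_comparisons (fun i => f i w) phi_semicoherent mn;
  [apply: c_life | apply: life_c].
Qed.

End measurability.

(** * Exchangeability of independent identically distributed lifetimes *)

Section joint_law.
Context d (Omega : measurableType d) (R : realType) (P : probability Omega R)
  (n : nat).

Definition vector_of (T : 'I_n -> {RV P >-> R}) (w : Omega) : n.-tuple R :=
  [tuple T i w | i < n].

Lemma measurable_vector_of (T : 'I_n -> {RV P >-> R}) :
  measurable_fun setT (vector_of T).
Proof.
apply/measurable_fun_tnthP => i.
by apply: (eq_measurable_fun (T i)) => // w _; rewrite /= tnth_mktuple.
Qed.

Definition rectangle (B : 'I_n -> set R) : set (n.-tuple R) :=
  [set t | forall i, B i (tnth t i)].

Lemma rectangle_generate :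
  @measurable _ (n.-tuple R) =
  <<s [set A | exists2 B, (forall i, measurable (B i)) & A = rectangle B] >>.
Proof.
apply/seteqP; split.
  apply: smallest_sub; first exact: smallest_sigma_algebra.
  move=> A; rewrite -bigcup_seq => -[i _ [B mB <-]].
  apply: sub_sigma_algebra; exists (fun j => if j == i then B else setT).
    by move=> j; case: eqP.
  apply/seteqP; split=> [t [_ Bt] j|t Bt]; first by case: eqP => // ->.
  by split=> //; have := Bt i; rewrite eqxx.
apply: smallest_sub; first exact: sigma_algebra_measurable.
move=> _ [B mB ->].
have -> : rectangle B = \bigcap_(i in setT) ((@tnth n R ^~ i) @^-1` B i).
  by apply/seteqP; split=> [t Bt i _|t Bt i]; apply: Bt.
apply: fin_bigcap_measurable => // i _; rewrite -[X in measurable X]setTI.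
exact: measurable_tnth.
Qed.

Lemma independent_rectangle (T : 'I_n -> {RV P >-> R}) (B : 'I_n -> set R) :
  mutually_independent T -> (forall i, measurable (B i)) ->
  P (vector_of T @^-1` rectangle B) = (\prod_(i < n) P (T i @^-1` B i))%E.
Proof.
move=> indT mB; have := indT [set: 'I_n]%SET B mB.
rewrite [RHS](eq_bigl predT) => [<-|i]; last by rewrite finset.in_setT.
congr (P _); apply/seteqP; split=> w.
  by move=> H i _; have := H i; rewrite tnth_mktuple.
by move=> H i; rewrite tnth_mktuple; apply: H; rewrite /= finset.in_setT.
Qed.

(** The two joint laws agree on rectangles, which are stable under
    intersection and generate the sigma-algebra. *)
Lemma independent_law_unique (X Y : 'I_n -> {RV P >-> R}) :
  mutually_independent X -> mutually_independent Y ->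
  (forall i B, measurable B -> P (X i @^-1` B) = P (Y i @^-1` B)) ->
  forall S : set (n.-tuple R), measurable S ->
    P (vector_of X @^-1` S) = P (vector_of Y @^-1` S).
Proof.
move=> indX indY eqXY S mS.
pose VX := [the {mfun Omega >-> n.-tuple R} of
  mfun_Sub (mem_set (measurable_vector_of X))].
pose VY := [the {mfun Omega >-> n.-tuple R} of
  mfun_Sub (mem_set (measurable_vector_of Y))].
have := @measure_unique _ R _ _ (fun=> setT) rectangle_generate _ _ _
  (distribution P VX) (distribution P VY) _ _ S mS.
apply.
- move=> _ _ [B mB ->] [C mC ->]; exists (fun i => B i `&` C i).
    by move=> i; apply: measurableI.
  apply/seteqP; split=> [t [Bt Ct] i|t BCt]; first by split.
  by split=> i; have [] := BCt i.
- by move=> _; exists (fun=> setT) => //; apply/seteqP; split.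
- by rewrite bigcup_const.
- move=> _ [B mB ->].
  change (P (vector_of X @^-1` rectangle B) = P (vector_of Y @^-1` rectangle B)).
  by rewrite !independent_rectangle //; apply: eq_bigr => i _; apply: eqXY.
- by move=> k; apply: fin_num_fun_lty; apply: fin_num_measure.
Qed.

Lemma iid_exchangeable (T : 'I_n -> {RV P >-> R}) (s : 'S_n) :
  mutually_independent T -> identically_distributed T ->
  forall S : set (n.-tuple R), measurable S ->
    P (vector_of T @^-1` S) = P (vector_of (T \o s) @^-1` S).
Proof.
move=> indT idT; apply: independent_law_unique => //; last first.
  by move=> i B mB; apply: idT.
move=> J B mB.
have := indT (s @: J)%SET (fun i => B ((s^-1)%g i)) (fun i => mB _).
rewrite big_imset /=; last by move=> i j _ _; apply: perm_inj.
under eq_bigr do rewrite permK.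
move=> <-; congr (P _); apply/seteqP; split=> w H i.
  by move=> /imsetP[j jJ ->] /=; rewrite permK; apply: (H j).
by move=> iJ; have := H (s i) (imset_f _ iJ); rewrite /= permK.
Qed.

End joint_law.

(** The indicator tuples of A and B have as many entries true, so one is a
    rearrangement of the other. *)
Lemma perm_of_card (n : nat) (A B : {set 'I_n}) : #|A| = #|B| ->
  exists s : 'S_n, forall i, (i \in A) = (s i \in B).
Proof.
move=> cAB.
have /tuple_permP[s eAB] :
    perm_eq [tuple i \in A | i < n] [tuple i \in B | i < n].
  have C b (D : {set 'I_n}) : count_mem b [tuple i \in D | i < n] =
      #|if b then D else (~: D)%SET|.
    rewrite count_map cardE size_filter -enumT; apply: eq_count => i /=.
    by case: b; rewrite ?finset.in_setC; case: (i \in D).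
  apply/allP => -[] _; rewrite /= !C; first by rewrite cAB.
  by rewrite -(eqn_add2l #|A|) cardsC cAB cardsC.
exists s => i; move/(congr1 (fun u => nth false u i)): eAB.
by rewrite -!tnth_nth !tnth_mktuple.
Qed.

(** * Almost sure absence of ties *)

Section ties.
Context d (Omega : measurableType d) (R : realType) (P : probability Omega R).

(** The mass at y is at most cdf X y - cdf X (y - 1/(k+1)) for every k. *)
Lemma continuous_cdf_point (X : {RV P >-> R}) (y : R) :
  continuous (cdf X) -> distribution P X [set y] = 0%E.
Proof.
move=> cX; apply/eqP; rewrite eq_le measure_ge0 andbT.
have fin r : cdf X r \is a fin_num by apply: fin_num_measure.
have bound k :
    (distribution P X [set y] + cdf X (y - k.+1%:R^-1) <= cdf X y)%E.
  rewrite /cdf -measureU //.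
    apply: le_measure; rewrite ?inE //; first exact: measurableU.
    move=> z [-> /=|/=]; rewrite !in_itv /= ?lexx // => /le_trans; apply.
    by rewrite lerBlDr lerDl invr_ge0.
  apply/seteqP; split=> // z [-> /=]; rewrite in_itv /= leNgt => /negP; apply.
  by rewrite ltrBlDr ltrDl invr_gt0.
have cvg_y : (y - k.+1%:R^-1) @[k --> \oo] --> y.
  rewrite -[X in _ --> X]subr0; apply: cvgB; first exact: cvg_cst.
  exact: cvg_harmonic.
have cvg_left : cdf X (y - k.+1%:R^-1) @[k --> \oo] --> cdf X y.
  exact: cvg_comp cvg_y (cX y).
have cvg_sum :
    (distribution P X [set y] + cdf X (y - k.+1%:R^-1))%E @[k --> \oo]
    --> (distribution P X [set y] + cdf X y)%E.
  apply: cvgeD; [|exact: cvg_cst|exact: cvg_left].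
  by rewrite fin_num_adde_defl.
have : (distribution P X [set y] + cdf X y <= cdf X y)%E.
  by apply: cvge_to_le cvg_sum _; apply: nearW.
by rewrite -[leRHS]add0e leeD2rE.
Qed.

(** By Fubini: the joint law is the product of the two laws, and the diagonal
    meets each vertical line in a point, a null set for the law of Y. *)
Lemma independent_ties (X Y : {RV P >-> R}) :
  (forall B C, measurable B -> measurable C ->
    P (X @^-1` B `&` Y @^-1` C) = (P (X @^-1` B) * P (Y @^-1` C))%E) ->
  continuous (cdf Y) -> P [set w | X w = Y w] = 0%E.
Proof.
move=> indXY cY.
have mXY : measurable_fun setT (fun w => (X w, Y w)).
  by apply: measurable_fun_pair.
pose XY := [the {mfun Omega >-> (R * R)%type} of mfun_Sub (mem_set mXY)].
pose D : set (R * R) := [set z | z.1 == z.2].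
have mD : measurable D.
  rewrite /D -(preimage_true (fun z : R * R => z.1 == z.2)).
  by rewrite -[X in measurable X]setTI; apply: measurable_fun_eqr.
have <- : distribution P XY D = P [set w | X w = Y w].
  congr (P _); apply/seteqP; split=> w /=; first by move/eqP.
  by move=> e; rewrite /D /=; apply/eqP.
rewrite -(@product_measure_unique _ _ _ _ _ (distribution P X)
  (distribution P Y) (distribution P XY)) //.
rewrite /product_measure1 integral0_eq // => x _ /=.
rewrite -(continuous_cdf_point x cY); congr (P _); apply: congr1.
by apply/seteqP; split=> [z|_ ->]; rewrite /xsection /= inE /D /= => // /eqP.
Qed.

Lemma lifetimes_distinct (n : nat) (T : 'I_n -> {RV P >-> R}) :
  continuous_iid T -> P [set w | injective (fun i => T i w)] = 1%E.
Proof.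
move=> [indT idT cT].
have pair i j : i != j -> P [set w | T i w = T j w] = 0%E.
  move=> ij; apply: independent_ties => // B C mB mC.
  have := indT [set i; j]%SET (fun k => if k == i then B else C).
  rewrite big_setU1 ?finset.in_set1 //= big_set1 eqxx eq_sym (negPf ij) => <-.
    congr (P _); apply/seteqP; split=> w /=.
      move=> [Bw Cw] k /=; rewrite !finset.inE => /orP[]/eqP -> /=.
        by rewrite eqxx.
      by rewrite eq_sym (negPf ij).
    move=> H; split.
      by have := H i; rewrite /= !finset.inE !eqxx; apply.
    have := H j; rewrite /= !finset.inE !eqxx orbT eq_sym (negPf ij).
    by apply.
  by move=> k; case: eqP.
have mtie (p : 'I_n * 'I_n) : measurable [set w | T p.1 w = T p.2 w].
  rewrite (_ : [set w | _] = [set w | T p.1 w == T p.2 w]); last first.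
    by apply/seteqP; split=> w /= /eqP.
  rewrite -(preimage_true (fun w => T p.1 w == T p.2 w)).
  by rewrite -[X in measurable X]setTI; apply: measurable_fun_eqr.
pose N := \big[setU/set0]_(p : 'I_n * 'I_n | p.1 != p.2)
  [set w | T p.1 w = T p.2 w].
have [mN N0] : measurable N /\ P N = 0%E.
  rewrite /N; elim/big_rec: _ => [|p A pij [mA A0]]; first by rewrite measure0.
  by split; [apply: measurableU | apply: null_set_setU => //; apply: pair].
have -> : [set w | injective (fun i => T i w)] = ~` N.
  rewrite /N -bigcup_seq_cond; apply/seteqP; split=> w.
    by move=> /= injw [[i j] /= /andP[_ ij] /injw] /eqP; apply/negP.
  move=> Nw i j Tij; apply/eqP; apply: contra_notT Nw => ij.
  by exists (i, j) => //=; rewrite mem_index_enum.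
by rewrite probability_setC // N0 sube0.
Qed.

Lemma measure_finite_union (I : finType) (Q : pred I) (F : I -> set Omega) :
  (forall i, measurable (F i)) ->
  (forall i j w, Q i -> Q j -> F i w -> F j w -> i = j) ->
  P [set w | exists2 i, Q i & F i w] = (\sum_(i | Q i) P (F i))%E.
Proof.
move=> mF disj.
have -> : [set w | exists2 i, Q i & F i w] = \bigcup_(i in [set` Q]) F i by [].
rewrite measure_fin_bigcup //.
  by rewrite [RHS]bigfs ?index_enum_uniq // => i _; rewrite mem_index_enum.
by move=> i j /= Qi Qj [w [Fi Fj]]; apply: disj Fi Fj.
Qed.

Lemma eq_probability_on (G A B : set Omega) : measurable G -> measurable A ->
  measurable B -> P G = 1%E -> (forall w, G w -> A w <-> B w) -> P A = P B.
Proof.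
move=> mG mA mB PG AB.
have PI (C : set Omega) : measurable C -> P C = P (C `&` G).
  move=> mC; have mCG : measurable (C `&` ~` G).
    by apply: measurableI => //; apply: measurableC.
  have PnG : P (~` G) = 0%E by rewrite probability_setC // PG subee.
  rewrite -(@measureU0 _ _ _ P (C `&` G) (C `&` ~` G)) //.
  - by rewrite -setIUr setUv setIT.
  - exact: measurableI.
  - by apply: subset_measure0 PnG => //; apply: measurableC.
rewrite (PI A) // (PI B) //; congr (P _).
by apply/seteqP; split=> w [Hw Gw]; split=> //; apply/AB.
Qed.

End ties.

(** * Boland's formula *)

Section boland.
Context d (Omega : measurableType d) (R : realType) (P : probability Omega R)
  (n : nat) (T : 'I_n -> {RV P >-> R}) (T_iid : continuous_iid T).

Lemma top_set_exchangeable (A B : {set 'I_n}) : #|A| = #|B| ->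
  P [set w | top_set (fun i => T i w) A]
    = P [set w | top_set (fun i => T i w) B].
Proof.
move=> /perm_of_card[s sAB]; have [indT idT _] := T_iid.
pose S : set (n.-tuple R) := [set t | top_set (tnth t) A].
have mS : measurable S by apply: measurable_top_set => i; exact: measurable_tnth.
have eT (X : 'I_n -> {RV P >-> R}) w :
    top_set (tnth (vector_of X w)) A = top_set (fun i => X i w) A.
  by apply: eq_forallb => i; apply: eq_forallb => j; rewrite !tnth_mktuple.
transitivity (P (vector_of T @^-1` S)).
  by congr (P _); apply/seteqP; split=> w; rewrite /S /= eT.
rewrite (iid_exchangeable s) //; congr (P _).
apply/seteqP; split=> w; rewrite /S /= eT => /top_setP tA; apply/top_setP => i j.
  by rewrite -(permKV s i) -(permKV s j) -!sAB; apply: tA.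
by rewrite !sAB; apply: tA.
Qed.

(** The events that B is a top set, for B of the size of A, are equally likely
    and disjoint, and almost surely one of them occurs. *)
Lemma top_set_probability (A : {set 'I_n}) :
  P [set w | top_set (fun i => T i w) A] = ('C(n, #|A|)%:R^-1)%:E.
Proof.
pose E B := [set w | top_set (fun i => T i w) B].
have mE B : measurable (E B) by apply: measurable_top_set.
have cA : (#|A| <= n)%N by rewrite -[leqRHS]card_ord max_card.
have mU : measurable [set w | exists2 B : {set 'I_n}, #|B| == #|A| & E B w].
  by apply: fin_bigcup_measurable.
have total : P [set w | exists2 B : {set 'I_n}, #|B| == #|A| & E B w] = 1%E.
  rewrite -(@probability_setT _ _ _ P).
  have mD := measurable_distinct (fun i => measurable_funPT (T i)).
  apply: (eq_probability_on mD) => //; first exact: lifetimes_distinct.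
  move=> w injw; split=> // _.
  by have [B /eqP cB tB] := top_set_exists injw cA; exists B.
move: total; rewrite measure_finite_union //; last first.
  by move=> B C w /eqP cB /eqP cC tB tC; apply: top_set_inj tB tC _; rewrite cB.
rewrite (eq_bigr (fun=> P (E A))); last by move=> B /eqP /top_set_exchangeable.
rewrite -/(E A) -(fineK (fin_num_measure P _ (mE A))) sumEFin => -[].
rewrite sumr_const -cardsE card_draws card_ord => eq1.
have nz : 'C(n, #|A|)%:R != 0 :> R by rewrite pnatr_eq0 -lt0n bin_gt0.
by congr (_%:E); apply: (mulIf nz); rewrite mulVf // mulr_natr.
Qed.

Context (phi : {set 'I_n} -> bool) (phi_semicoherent : semicoherent phi).

Lemma top_is_path_probability (m : nat) :
  P [set w | top_is_path phi (fun i => T i w) m] = (path_density R phi m)%:E.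
Proof.
have -> : [set w | top_is_path phi (fun i => T i w) m] =
    [set w | exists2 A : {set 'I_n}, phi A && (#|A| == m)
           & top_set (fun i => T i w) A].
  by apply/seteqP; split=> w /top_is_pathP.
rewrite measure_finite_union.
- rewrite (eq_bigr (fun=> ('C(n, m)%:R^-1)%:E)); last first.
    by move=> A /andP[_ /eqP cA]; rewrite -[in RHS]cA top_set_probability.
  rewrite sumEFin sumr_const -[_ *+ #|_|]mulr_natl /path_density /path_count.
  by congr ((_%:R * _)%:E); apply: eq_card => A; rewrite !inE.
- by move=> A; apply: measurable_top_set.
- move=> A B w /andP[_ /eqP cA] /andP[_ /eqP cB] tA tB.
  by apply: top_set_inj tA tB _; rewrite cA.
Qed.

(** With H m the event that the m longest-lived components form a path set, the
    system fails at the k-th failure iff H (n - k + 1) holds and H (n - k) does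
    not, where H (n - k) implies H (n - k + 1). *)
Lemma signature_path_density (k : nat) : (1 <= k <= n)%N ->
  signature phi T k = difference (path_density R phi) (n - k).
Proof.
case: k => // m /= mn.
pose H m := [set w | top_is_path phi (fun i => T i w) m].
have mT i : measurable_fun setT (T i) := measurable_funPT (T i).
have mD := measurable_distinct mT.
have PD := lifetimes_distinct T_iid.
have mH l : measurable (H l) by apply: measurable_top_is_path.
have mHD : measurable (H (n - m)%N `\` H (n - m.+1)%N) by apply: measurableD.
have eqS : P [set w | system_lifetime phi T w = (order_statistic T m.+1 w)%:E]
    = P (H (n - m)%N `\` H (n - m.+1)%N).
  apply: (eq_probability_on mD _ mHD PD).
    exact: measurable_maxmin_eq_nth_sort.
  move=> w injw; rewrite -[X in X <-> _]/(maxmin phi (fun i => T i w) = _).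
  rewrite (maxmin_eq_nth_sort phi_semicoherent injw mn).
  by split=> [/andP[Hm /negP]|[Hm /negP]] //; rewrite /H /= Hm.
have eqH : (P (H (n - m)%N) =
    P (H (n - m)%N `\` H (n - m.+1)%N) + P (H (n - m.+1)%N))%E.
  rewrite -measureU //; last by rewrite setDKI.
  apply: (eq_probability_on mD _ _ PD) => //; first exact: measurableU.
  move=> w injw; split=> [Hm|[[]//|]]; last exact: top_is_path_succ.
  by case: (pselect (H (n - m.+1)%N w)); [right|left].
rewrite /signature eqS.
move: eqH; rewrite /H !top_is_path_probability => eqH.
have -> : P (H (n - m)%N `\` H (n - m.+1)%N) =
    (path_density R phi (n - m) - path_density R phi (n - m.+1))%:E.
  by rewrite EFinB eqH addeK.
by rewrite /= /difference subnSK.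
Qed.

End boland.

Theorem proposition3 (disp : measure_display) (Omega : measurableType disp)
    (R : realType) (P : probability Omega R) (n : nat) (n_ge1 : (1 <= n)%N)
    (phi : {set 'I_n} -> bool) (phi_semicoherent : semicoherent phi)
    (T : 'I_n -> {RV P >-> R}) (T_iid : continuous_iid T) :
  let s := signature phi T in
  let d := domination R phi in
  [/\ forall k : nat, (1 <= k <= n)%N ->
        s k = \sum_(0 <= j < (n - k).+1)
                ('C(n - j, k)%:R / 'C(n, k)%:R) * (j.+1%:R / (n - j)%:R) * d j.+1
        /\
        s k = \sum_(1 <= j < (n - k + 1).+1)
                ('C(n - k, j.-1)%:R / 'C(n, j)%:R) * d j,
      forall k : nat, (1 <= k <= n)%N ->
        d k = 'C(n, k)%:R *
              \sum_(0 <= j < k) (-1) ^+ (k.-1 - j) * 'C(k.-1, j)%:R * s (n - j)%N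
    & forall k : nat, (1 <= k <= n)%N ->
        d k = 'C(n, k)%:R *
              iter k.-1 (@difference R) (fun i : nat => s (n - i)%N) 0%N].

Proof.
move=> s d; apply: path_density_difference_formulas => k kn.
exact: signature_path_density.
Qed.
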